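(* Let $n\geq 3$, $k\geq 2$ and $q\geq 3$ be integers, and let $p=q+1+x$ where $x\in\{0,1\}$ and $x\equiv q+1 \pmod 2$. Let $C_{n,k}$ be any graph obtained from the cycle $C_n$ by attaching at least $2$ and at most $k$ pendant vertices to each vertex of $C_n$. Then \[2\log_3(2)\log_2\left(\tfrac{n}{200}\right)\leq \operatorname{Z}_q(C_{n,k})\leq (p-2)\log_2(n)+p+k-q+q(k-1).\]
   Context: Graphs are finite, simple and undirected. The number of pendant (degree-one) vertices attached may vary from one cycle vertex to another. The $\operatorname{Z}_q$-forcing game ($q\ge 0$ an integer) is played on a graph $G$ by two players, Blue (who has tokens) and White. All vertices of $G$ are initially white. Blue repeatedly applies one of the following rules until all vertices are blue. Rule 1: for one token, Blue can change any vertex from white to blue. Rule 2: at no cost, if a blue vertex $v$ of $G$ has exactly one white neighbor $w$, Blue may turn $w$ blue. Rule 3: let $B$ be the current set of blue vertices and let $W_1,\dots,W_r$ be the vertex sets of the connected components of $G[V(G)\setminus B]$. Blue selects at least $q+1$ of the $W_i$ and announces the selection to White (so this rule needs $r\ge q+1$). White then selects a nonempty subset $\{W_{i_1},\dots,W_{i_\ell}\}$ of the announced components and announces it back to Blue. At no cost, Blue can apply Rule 2 on the induced subgraph $G[B\cup W_{i_1}\cup\cdots\cup W_{i_\ell}]$. The $\operatorname{Z}_q$-forcing number $\operatorname{Z}_q(G)$ is the fewest number of tokens Blue must spend to color all of $G$ blue, under adversarial play by White. *)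

(* Defs.v *)
From HB Require Import structures.
From mathcomp Require Import all_boot all_order all_algebra.
From mathcomp Require Import boolp reals exp.

Set Implicit Arguments.
Unset Strict Implicit.
Unset Printing Implicit Defensive.

(* A finite simple graph is a finType T with a symmetric irreflexive relation
   e : rel T. *)

Section ZqForcing.

Variables (T : finType) (e : rel T).

Definition white_adj (B : {set T}) : rel T :=
  [rel u v | [&& u \notin B, v \notin B & e u v]].

Definition white_components (B : {set T}) : {set {set T}} :=
  equivalence_partition (connect (white_adj B)) (~: B).

(* One application of Rule 2 on the induced subgraph G[B :|: W]. *)
Definition forces_in (W B B' : {set T}) : Prop :=
  exists v w : T, [/\ v \in B,
                      [set u in (B :|: W) | (u \notin B) && e v u] = [set w]
                    & B' = w |: B].

(* blue_wins q t B: from the blue set B, Blue can colour everything blue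
   spending at most t tokens, whatever White plays. In rule3, A is the
   announced selection, S is White's answer, and r S is the blue set after
   Blue's reply; Blue is allowed not to use the offered force. *)
Inductive blue_wins (q : nat) : nat -> {set T} -> Prop :=
| all_blue t : blue_wins q t [set: T]
| rule1 t (B : {set T}) v :
    v \notin B -> blue_wins q t (v |: B) -> blue_wins q t.+1 B
| rule2 t (B B' : {set T}) :
    forces_in [set: T] B B' -> blue_wins q t B' -> blue_wins q t B
| rule3 t (B : {set T}) (A : {set {set T}}) (r : {set {set T}} -> {set T}) :
    A \subset white_components B ->
    q.+1 <= #|A| ->
    (forall S : {set {set T}}, S \subset A -> S != set0 ->
       r S = B \/ forces_in (cover S) B (r S)) ->
    (forall S : {set {set T}}, S \subset A -> S != set0 ->
       blue_wins q t (r S)) ->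
    blue_wins q t B.

Lemma blue_wins_all_tokens q (B : {set T}) : blue_wins q #|~: B| B.
Proof.
have [m] := ubnP #|~: B|; elim: m B => // m IHm B leBm.
have [/eqP|[v]] := set_0Vmem (~: B).
  rewrite -setCT (inj_eq (@setC_inj T)) => /eqP ->.
  exact: all_blue.
rewrite inE => vB.
have cardB : #|~: B| = #|~: (v |: B)|.+1.
  by rewrite (cardsD1 v) inE vB setCU setIC -setDE.
rewrite cardB; apply: (rule1 vB); apply: IHm.
by rewrite -ltnS -cardB.
Qed.

Lemma ex_blue_wins q : exists t, `[< blue_wins q t set0 >].
Proof.
by exists #|~: (set0 : {set T})|; apply/asboolP; exact: blue_wins_all_tokens.
Qed.

Definition Zq (q : nat) : nat := ex_minn (ex_blue_wins q).

End ZqForcing.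

Section PendantCycle.

Variables (n : nat) (m : 'I_n -> nat).

(* inl i is the i-th vertex of the cycle; inr (Tagged _ j) with j : 'I_(m i)
   is the j-th pendant vertex attached to it. *)
Definition pendant_cycle_vertex : finType := ('I_n + {i : 'I_n & 'I_(m i)})%type.

(* ordS i is i + 1 modulo n. *)
Definition pendant_cycle : rel pendant_cycle_vertex := fun u v =>
  match u, v with
  | inl i, inl j => (j == ordS i) || (i == ordS j)
  | inl i, inr s => tag s == i
  | inr s, inl i => tag s == i
  | inr _, inr _ => false
  end.

Lemma pendant_cycle_sym : symmetric pendant_cycle.
Proof. by move=> [i|s] [j|s'] //=; rewrite orbC. Qed.

Lemma pendant_cycle_irr : 1 < n -> irreflexive pendant_cycle.
Proof.
move=> n_gt1 [i|s] //=; rewrite orbb -val_eqE /=.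
have := ltn_ord i; rewrite leq_eqVlt => /orP[/eqP eq_in|lt_in].
  rewrite eq_in modnn; apply/negbTE/eqP => i0.
  by move: n_gt1; rewrite -eq_in i0.
by rewrite modn_small // ltn_eqF.
Qed.

End PendantCycle.

Arguments pendant_cycle {n} m _ _.

Local Open Scope ring_scope.

Definition log (R : realType) (b y : R) : R := ln y / ln b.

(* Main.v *)
Require Import Defs.
From HB Require Import structures.
From mathcomp Require Import all_boot all_order all_algebra.
From mathcomp Require Import reals exp.
From mathcomp Require Import zify ring lra.
From mathcomp Require Import boolp.

Set Implicit Arguments.
Unset Strict Implicit.
Unset Printing Implicit Defensive.

(** Both bounds come from looking at which announcements leave White an answer
that forces nothing.

Lower bound.  Call a set F of white vertices a fort when it has at most q
outside neighbours, each of them with at least two neighbours in F.  Rule 2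
cannot enter a fort.  Neither can Rule 3: among q + 1 announced components,
two different subfamilies give every one of the at most q outside neighbours
degrees of the same parity, because there are more subfamilies than parity
patterns; White answers with the symmetric difference of the two, which meets
the neighbourhood of each outside neighbour in an even number of vertices,
never in exactly one ([even_subfamily]).  So only a token can hit a fort
([fort_blue_wins]), and it suffices to have a fort that still contains a fort
after each token.  A stretch of the cycle together with its pendant vertices is
a fort bounded by its two extreme cycle vertices, and so is such a stretch with
one inner cycle vertex removed, bounded by three vertices.  A first token in
the stretch removes one vertex from it; a second token leaves three gaps, the
longest of which is a stretch of at least a third of the length.  Hence two
tokens only divide the length by 3, and Z_q is at least 2 floor(log_3 n)
([Zq_lower]).

Upper bound.  Blue starts with tokens on cycle vertices, among them two
consecutive ones, so that the cycle behaves like a path.  Call a blue cycle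
vertex active when it has a white neighbour.  If there are more than q active
vertices, Blue progresses for free: to each active vertex assign the white
component on its left, or one of its white pendant vertices if there is no
such component; a vertex that has neither can apply Rule 2.  These components
are distinct, and whatever White keeps of
them, the rightmost active vertex whose component is kept sees exactly one
white vertex ([free_force]).  Once at most q vertices are active, there are at
most q - 1 white runs on the cycle ([card_run_starts]), and q - 1 tokens on
their midpoints halve their length ([halve_gaps]).  With p + 1 initial tokens
at distance 2^r, where 2^(r+1) <= n < 2^(r+2), after r rounds the cycle is
blue, and q (k - 1) tokens finish, since an active vertex with a single white
pendant neighbour forces it.  The total p + 1 + r (q - 1) + q (k - 1) is below
the claimed bound because r + 1 <= log_2 n and q - 1 <= p - 2. *)

(** * Forts *)

Lemma disjointsU1 (T : finType) (v : T) (F B : {set T}) :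
  [disjoint F & v |: B] = (v \notin F) && [disjoint F & B].
Proof.
rewrite disjoint_sym -(disjoint_sym B) -disjointU1.
by apply: eq_disjoint => u; rewrite !inE.
Qed.

Section Forts.

Variables (T : finType) (e : rel T).

Definition boundary (F : {set T}) : {set T} :=
  [set v in ~: F | [exists w in F, e v w]].

Definition fort (q : nat) (F : {set T}) : Prop :=
  #|boundary F| <= q /\
  {in boundary F, forall v, 1 < #|[set w in F | e v w]|}.

(** The sets White can keep partly white while Blue spends t tokens: whichever
vertex of F a token hits, what remains still contains such a set for one token
fewer. *)
Fixpoint resists (q t : nat) (F : {set T}) : Prop :=
  [/\ F != set0, fort q F
    & if t is t'.+1 then
        {in F, forall u, exists2 F' : {set T}, F' \subset F :\ u & resists q t' F'}
      else True].

Lemma resistsE q t F : resists q t F -> F != set0 /\ fort q F.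
Proof. by case: t => [|t] []. Qed.

(** White's answer.  There are 2^#|A| subfamilies of A but only 2^#|K| parity
patterns on K; the symmetric difference of two subfamilies with the same
pattern has even degree at every vertex of K. *)
Lemma even_subfamily (A : {set {set T}}) (K : {set T}) :
  trivIset A -> #|K| < #|A| ->
  exists S : {set {set T}}, [/\ S \subset A, S != set0
    & {in K, forall v, ~~ odd #|[set u in cover S | e v u]|}].
Proof.
move=> trA ltKA.
pose deg v (S : {set {set T}}) := \sum_(W in S) #|[set u in W | e v u]|.
pose sig S := [set v in K | odd (deg v S)].
have /dinjectivePn[S1 SA1 [S2 /andP[/= neS SA2] eqS]] :
    ~~ dinjectiveb sig (powerset A).
  apply/negP => /dinjectiveP/card_in_imset eqc.
  have : sig @: powerset A \subset powerset K.
    apply/subsetP => _ /imsetP[S _ ->]; rewrite powersetE.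
    by apply/subsetP => v; rewrite inE => /andP[].
  by move/subset_leq_card; rewrite eqc !card_powerset leq_exp2l // leqNgt ltKA.
rewrite !powersetE in SA1 SA2.
have degE (S : {set {set T}}) v : S \subset A ->
    #|[set u in cover S | e v u]| = deg v S.
  move=> /trivIsetS/(_ trA) trS.
  rewrite -sum1dep_card big_mkcondr big_trivIset //=.
  by apply: eq_bigr => W _; rewrite -sum1dep_card big_mkcondr.
exists ((S1 :\: S2) :|: (S2 :\: S1)); split.
- by rewrite subUset !(subset_trans (subsetDl _ _)).
- apply: contraNneq neS => /eqP; rewrite setU_eq0 !setD_eq0 => /andP[s12 s21].
  by apply/eqP/setP/subset_eqP/andP.
move=> v vK; rewrite degE; last first.
  by rewrite subUset !(subset_trans (subsetDl _ _)).
have disD : [disjoint S1 :\: S2 & S2 :\: S1].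
  by rewrite -setI_eq0; apply/eqP/setP => W; rewrite !inE; do 2!case: (W \in _).
rewrite /deg (eq_bigl [predU S1 :\: S2 & S2 :\: S1]) /= ?bigU //=; last first.
  by move=> W; rewrite !inE.
have /setP/(_ v) : sig S1 = sig S2 by [].
rewrite !inE vK /= /deg (big_setID S2) [in RHS](big_setID S1) /= setIC !oddD.
by do 3!case: (odd _).
Qed.

Hypothesis e_sym : symmetric e.

Lemma white_components_partition (B : {set T}) :
  partition (white_components e B) (~: B).
Proof.
have symW : connect_sym (white_adj e B).
  by apply: sym_connect_sym => u v; rewrite /white_adj /= andbCA e_sym.
apply: equivalence_partitionP => x y z _ _ _.
by split=> [|/(same_connect symW)->].
Qed.

(** Free moves never colour a vertex of a fort: a forcing vertex would lie in the
boundary, where Rule 2 sees at least two white vertices and White's even answer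
to Rule 3 shows a number of white vertices different from one. *)
Lemma fort_blue_wins q t s (F B : {set T}) :
  resists q t F -> [disjoint F & B] -> blue_wins e q s B -> t < s.
Proof.
move=> + + win; elim: win t F => {s B}.
- move=> s t F /resistsE[F0 _]; rewrite disjoint_sym => /disjoint_setI0.
  by rewrite setTI => F_eq0; rewrite F_eq0 eqxx in F0.
- move=> s B v vB _ IH t F resF disF.
  have [vF|vF] := boolP (v \in F); last first.
    apply: ltnW; rewrite ltnS; apply: (IH _ F) => //.
    by rewrite disjointsU1 vF.
  case: t resF => [//|t] [_ _ /(_ v vF)[F' sF' resF']].
  rewrite ltnS; apply: (IH _ F') => //.
  rewrite disjointsU1; apply/andP; split.
    by apply/negP => /(subsetP sF'); rewrite !inE eqxx.
  exact: disjointWl (subset_trans sF' (subsetDl _ _)) disF.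
- move=> s B B' [v [w [vB eqw ->]]] _ IH t F resF disF.
  apply: (IH _ F) => //; rewrite disjointsU1 disF andbT.
  apply/negP => wF; have [_ [_ /(_ v)]] := resistsE resF.
  have : w \in [set w] by rewrite inE.
  rewrite -eqw !inE => /and3P[_ _ evw].
  rewrite (disjointFl disF vB) /=; have -> : [exists w in F, e v w].
    by apply/exists_inP; exists w.
  move=> /(_ isT); rewrite ltnNge => /negP; apply.
  rewrite -(cards1 w) -eqw subset_leq_card //; apply/subsetP => u.
  by rewrite !inE orbT => /andP[uF ->]; rewrite (disjointFr disF).
- move=> s B A r sA ltqA rP _ IH t F resF disF.
  have [_ [leq_bd _]] := resistsE resF.
  have /and3P[/eqP covW triW _] := white_components_partition B.
  have [S [SA S0 evenS]] :=
    even_subfamily (trivIsetS sA triW) (leq_ltn_trans leq_bd ltqA).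
  apply: (IH S SA S0 t F) => //.
  have [->//|[v [w [vB eqw ->]]]] := rP S SA S0.
  rewrite disjointsU1 disF andbT.
  apply/negP => wF.
  have whiteS u : u \in cover S -> u \notin B.
    move=> /bigcupP[W WS uW]; rewrite -in_setC -covW.
    by apply/bigcupP; exists W => //; apply: (subsetP sA); apply: (subsetP SA).
  have : w \in [set w] by rewrite inE.
  rewrite -eqw !inE => /and3P[_ wB evw].
  have /evenS : v \in boundary F.
    rewrite !inE (disjointFl disF vB) /=.
    by apply/exists_inP; exists w.
  suff -> : [set u in cover S | e v u] = [set w] by rewrite cards1.
  rewrite -eqw; apply/setP => u; rewrite !inE.
  have [/whiteS uB|uS] := boolP (u \in cover S); first by rewrite (negPf uB) orbT.
  by rewrite orbF; case: (u \in B).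
Qed.

(** At the start everything is white, so White may choose any fort. *)
Lemma resists_Zq q t F : resists q t F -> t < Zq e q.
Proof.
move=> resF; rewrite /Zq; case: ex_minnP => s /asboolP win _.
by apply: fort_blue_wins resF _ win; rewrite -setI_eq0 setI0.
Qed.

End Forts.

(** * Long stretches of the cycle resist many tokens *)

Section LowerBound.

Variables (n : nat) (m : 'I_n -> nat).
Hypothesis m_ge2 : forall i, 2 <= m i.

Notation V := (pendant_cycle_vertex m).

Definition position (u : V) : nat :=
  match u with inl i => i | inr s => tag s end.

(** The stretch of the cycle from l to r without the vertices at d: the pendant
vertices of l and r belong to it, the cycle vertices l and r bound it.  A value
of d outside the interval from l to r removes nothing. *)
Definition region (l d r : nat) : {set V} :=
  [set u : V | (position u != d) &&
     match u with inl i => l < i < r | inr s => l <= tag s <= r end].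

Definition arc (l r : nat) : {set V} := region l n r.

Lemma region_position l d r u : u \in region l d r ->
  [/\ l <= position u, position u <= r & position u != d].
Proof. by case: u => [i|s]; rewrite inE /= => /and3P[-> ? ?]; split=> //; lia. Qed.

Lemma region_leaves_gt1 l d r (i : 'I_n) : l <= i <= r -> i != d :> nat ->
  1 < #|[set w in region l d r | pendant_cycle m (inl i) w]|.
Proof.
move=> lir neid.
pose leaf j : V := inr (Tagged (fun i => 'I_(m i)) (j : 'I_(m i))).
apply/card_gt1P.
exists (leaf (Ordinal (ltnW (m_ge2 i)))), (leaf (Ordinal (m_ge2 i))); split.
- by rewrite !inE /= neid lir eqxx.
- by rewrite !inE /= neid lir eqxx.
- apply/eqP.
  by move=> /(congr1 (fun u : V => if u is inr s then val (tagged s) else 0)).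
Qed.

Lemma pendant_cycle_steps (i j : 'I_n) l r : l < i < r -> r < n ->
  pendant_cycle m (inl j) (inl i) -> j = i.+1 :> nat \/ i = j.+1 :> nat.
Proof.
move=> lir rn /= /orP[]/eqP/(congr1 val) /=; have := ltn_ord j.
  rewrite leq_eqVlt => /orP[/eqP->|ltj]; first by rewrite modnn; lia.
  by rewrite modn_small; lia.
by rewrite modn_small; lia.
Qed.

(** The boundary consists of l, r and, if it lies between them, d.  The vertices
l and r have two pendant neighbours inside; d must keep both its cycle
neighbours inside, hence its distance 2 to l and r. *)
Lemma region_fort q l d r : 3 <= q -> l <= r -> r < n ->
  (d < l) || (r < d) || (l + 2 <= d <= r - 2) ->
  fort (pendant_cycle m) q (region l d r).
Proof.
move=> q_ge3 lr rn dP.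
have bdP v : v \in boundary (pendant_cycle m) (region l d r) ->
    exists2 i : 'I_n, v = inl i & (nat_of_ord i) \in [:: l; r] \/
      (i = d :> nat) /\ (l + 2 <= d <= r - 2).
  rewrite inE in_setC => /andP[vF /exists_inP[w wF]].
  case: v vF => [j|s] vF; last first.
    case: w wF => // i; rewrite inE /= => /andP[di lir] /eqP si.
    by case/negP: vF; rewrite inE /= si di /=; lia.
  move=> evw; exists j => //; rewrite !inE.
  have [jd|jd] := eqVneq (j : nat) d.
    right; case: w wF evw => [i|s]; rewrite inE /= => /andP[id lir].
      by move=> /(pendant_cycle_steps lir rn); lia.
    by move=> /eqP sj; rewrite sj jd eqxx in id.
  left; move: vF; rewrite inE /= jd /= => vF.
  case: w wF evw => [i|s].
    by rewrite inE /= => /andP[_ lir] /(pendant_cycle_steps lir rn); lia.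
  by rewrite inE /= => /andP[_ lir] /eqP sj; move: lir; rewrite sj; lia.
split.
  apply: leq_trans q_ge3.
  rewrite cardE -(size_map position) -[3]/(size [:: l; r; d]).
  apply: uniq_leq_size.
    rewrite map_inj_in_uniq ?enum_uniq // => u v; rewrite !mem_enum.
    move=> /bdP[i -> _] /bdP[j -> _] /= ij.
    by congr inl; apply: val_inj.
  move=> x /mapP[v]; rewrite mem_enum => /bdP[i -> iP] -> /=.
  by move: iP; rewrite !inE; lia.
move=> v /bdP[i -> iP].
have [id|id] := eqVneq (i : nat) d; last first.
  by apply: region_leaves_gt1 => //; move: iP; rewrite !inE; lia.
have {dP iP} dP : l + 2 <= d <= r - 2 by move: iP; rewrite !inE; lia.
have iS : i.+1 < n by lia.
have iP : i.-1 < n by lia.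
apply/card_gt1P; exists (inl (Ordinal iS)), (inl (Ordinal iP)); split.
- rewrite !inE /= -!val_eqE /= modn_small // eqxx andbT; lia.
- rewrite !inE /= -!val_eqE /= prednK; last by lia.
  by rewrite [i %% n]modn_small // eqxx orbT andbT; lia.
- by apply/eqP => -[]; lia.
Qed.

Lemma region_neq0 l d r : l <= r -> r < n -> d != l -> region l d r != set0.
Proof.
move=> lr rn dl; have ln : l < n by lia.
have m0 := ltnW (m_ge2 (Ordinal ln)).
apply/set0Pn; exists (inr (Tagged (fun i => 'I_(m i)) (Ordinal m0))).
by rewrite inE /=; lia.
Qed.

Lemma arc_sub_region l d r l' r' u : r < n -> l <= l' -> r' <= r ->
  ~~ (l' <= d <= r') -> ~~ (l' <= position u <= r') ->
  arc l' r' \subset region l d r :\ u.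
Proof.
move=> rn ll rr dP uP; apply/subsetP => v vA.
have [lv vr _] := region_position vA.
rewrite in_setD1; apply/andP; split; first by apply: contraNneq uP => <-; lia.
by move: vA lv vr; rewrite !inE; case: v => [i|s] /=; lia.
Qed.

Variable q : nat.
Hypothesis q_ge3 : 3 <= q.

Definition arcs_resist (t L : nat) : Prop :=
  forall l r, r < n -> l + L <= r.+1 -> resists (pendant_cycle m) q t (arc l r).

Lemma arcs_resist0 : arcs_resist 0 1.
Proof.
move=> l r rn lr; split=> //.
  by apply: region_neq0; lia.
by apply: region_fort; lia.
Qed.

(** A token leaves L consecutive untouched positions on one of its sides. *)
Lemma arcs_resist_half t L : 0 < L -> arcs_resist t L ->
  arcs_resist t.+1 (2 * L + 1).
Proof.
move=> L0 HL l r rn lr; split.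
- by apply: region_neq0; lia.
- by apply: region_fort; lia.
move=> u uA; have [lu ur _] := region_position uA.
have [short|long] := leqP (l + L) (position u).
  exists (arc l (position u).-1); last by apply: HL; lia.
  by apply: arc_sub_region; lia.
exists (arc (position u).+1 r); last by apply: HL; lia.
by apply: arc_sub_region; lia.
Qed.

(** The position of the token and d cut the stretch into three gaps, one of
which has at least L positions since (3 L - 2) / 3 > L - 1. *)
Lemma region_resist t L l d r : 0 < L -> arcs_resist t L -> r < n ->
  l + 3 * L <= r.+1 -> l + 2 <= d <= r - 2 ->
  resists (pendant_cycle m) q t.+1 (region l d r).
Proof.
move=> L0 HL rn lr dP; split.
- by apply: region_neq0; lia.
- by apply: region_fort; lia.
move=> u uA; have [lu ur ud] := region_position uA.
pose w := minn (position u) d; pose z := maxn (position u) d.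
have [left|] := leqP (l + L) w.
  exists (arc l w.-1); last by apply: HL; lia.
  by apply: arc_sub_region; lia.
have [right|] := leqP (z + L) r.
  exists (arc z.+1 r); last by apply: HL; lia.
  by apply: arc_sub_region; lia.
move=> ? ?.
exists (arc w.+1 z.-1); last by apply: HL; lia.
by apply: arc_sub_region; lia.
Qed.

(** Two tokens divide the length by 3 only.  The first one becomes the removed
inner vertex of a region.  If it falls too near to an end for that, the rest
is an arc of at least 3 L - 2 >= 2 L + 1 positions. *)
Lemma arcs_resist_third t L : 3 <= L -> arcs_resist t L ->
  arcs_resist t.+2 (3 * L).
Proof.
move=> L3 HL l r rn lr; have L0 : 0 < L by lia.
have HL2 := arcs_resist_half L0 HL.
split.
- by apply: region_neq0; lia.
- by apply: region_fort; lia.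
move=> u uA; have [lu ur un] := region_position uA.
have [near_l|far_l] := ltnP (position u) (l + 2).
  exists (arc (l + 2) r); last by apply: HL2; lia.
  by apply: arc_sub_region; lia.
have [near_r|far_r] := ltnP r (position u + 2).
  exists (arc l (r - 2)); last by apply: HL2; lia.
  by apply: arc_sub_region; lia.
exists (region l (position u) r); last by apply: (region_resist L0 HL); lia.
apply/subsetP => v vR; have [lv vr vu] := region_position vR.
rewrite in_setD1; apply/andP; split.
  by apply: contraNneq vu => ->.
by move: vR un; rewrite !inE; have := ltn_ord; case: v lv vr vu => [i|s] /=; lia.
Qed.

(** An arc of 3 positions resists one token and each factor 3 is worth two more,
so an arc of 3^(s+1) positions resists 2 s + 1 tokens and Blue needs another. *)
Lemma Zq_lower s : 3 ^ s.+1 <= n -> 2 * s.+1 <= Zq (pendant_cycle m) q.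
Proof.
have HQ : arcs_resist (2 * s).+1 (3 ^ s.+1).
  elim: s => [|s IH]; first exact: arcs_resist_half arcs_resist0.
  rewrite mulnS -[_.+1]/(2 * s).+1.+2 expnS; apply: arcs_resist_third => //.
  by rewrite expnS; have := expn_gt0 3 s; lia.
move=> le_n; rewrite mulnS.
have /(resists_Zq (@pendant_cycle_sym n m)) : resists (pendant_cycle m) q
    (2 * s).+1 (arc 0 n.-1) by apply: HQ; have := expn_gt0 3 s.+1; lia.
by [].
Qed.

End LowerBound.

(** * Moves available to Blue in any graph *)

Section Strategies.

Variables (T : finType) (e : rel T) (q : nat).

Lemma blue_wins_leq s t B : s <= t -> blue_wins e q s B -> blue_wins e q t B.
Proof.
move=> + win; elim: win t => {s B}.
- by move=> s t _; apply: all_blue.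
- by move=> s B v vB _ IH [//|t] st; apply: (rule1 vB); apply: IH.
- by move=> s B B' F _ IH t st; apply: (rule2 F); apply: IH.
- by move=> s B A r sA qA rP _ IH t st; apply: (rule3 sA qA rP) => S SA S0; apply: IH.
Qed.

Lemma blue_wins_tokens t (B X : {set T}) :
  blue_wins e q t (X :|: B) -> blue_wins e q (t + #|X|) B.
Proof.
have [c] := ubnP #|X|; elim: c X B => // c IH X B Xc.
have [->|[x xX]] := set_0Vmem X; first by rewrite set0U cards0 addn0.
have cX := cardsD1 x X; rewrite xX in cX.
have -> : X :|: B = (X :\ x) :|: (x |: B).
  by rewrite setUA [_ :|: [set x]]setUC setD1K.
move=> /IH; rewrite cX addnS => win.
have {}win : blue_wins e q (t + #|X :\ x|) (x |: B) by apply: win; lia.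
have [xB|xB] := boolP (x \in B); last exact: rule1 xB win.
by apply: blue_wins_leq (leqnSn _) _; rewrite (setUidPr _) ?sub1set in win.
Qed.

Lemma forces_inI (W B : {set T}) v w : v \in B -> w \in W -> w \notin B ->
  e v w -> (forall u, u \in W -> u \notin B -> e v u -> u = w) ->
  forces_in e W B (w |: B).
Proof.
move=> vB wW wB evw uniq; exists v, w; split=> //.
apply/setP => u; rewrite !inE; apply/and3P/eqP => [[uBW uB]|->].
  by apply: uniq => //; rewrite (negPf uB) in uBW.
by rewrite wW orbT.
Qed.

(** Blue's replies to the different answers of White can be chosen
independently. *)
Lemma blue_wins_select t (B : {set T}) (A : {set {set T}}) :
  A \subset white_components e B -> q < #|A| ->
  (forall S : {set {set T}}, S \subset A -> S != set0 ->
     exists2 B', forces_in e (cover S) B B' & blue_wins e q t B') ->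
  blue_wins e q t B.
Proof.
move=> sA qA SP.
have /choice[r rP] : forall S : {set {set T}}, exists B',
    S \subset A -> S != set0 ->
    forces_in e (cover S) B B' /\ blue_wins e q t B'.
  move=> S; have [SA|_] := boolP (S \subset A); last by exists B.
  have [_|S0] := eqVneq S set0; first by exists B.
  by have [B' ? ?] := SP S SA S0; exists B'.
by apply: (rule3 (r := r) sA qA) => S SA S0; [right|]; have [] := rP S SA S0.
Qed.

End Strategies.

(** * Free progress when more than q vertices are active *)

Section UpperBound.

Variables (N : nat) (m : 'I_N.+1 -> nat) (q k : nat).
Hypothesis m_lek : forall i, m i <= k.

Notation V := (pendant_cycle_vertex m).
Notation e := (pendant_cycle m).

Definition white_leaves (B : {set V}) (i : 'I_N.+1) : {set V} :=
  [set u | (u \notin B) && if u is inr s then tag s == i else false].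

Definition active (B : {set V}) : {set 'I_N.+1} :=
  [set i | (inl i \in B) && [exists u, (u \notin B) && e (inl i) u]].

(** The first and the last position are adjacent on the cycle; once both are
blue, white runs no longer wrap around and positions compare as on a path. *)
Definition ends_blue (B : {set V}) : bool :=
  (inl ord0 \in B) && (inl ord_max \in B).

Lemma ends_blueS (B B' : {set V}) : B \subset B' -> ends_blue B -> ends_blue B'.
Proof. by move=> /subsetP sB /andP[/sB b0 /sB b1]; apply/andP. Qed.

Lemma ordS_white (B : {set V}) i : ends_blue B -> inl (ordS i) \notin B ->
  ordS i = i.+1 :> nat.
Proof.
move=> /andP[b0 _]; rewrite /=; have := ltn_ord i.
rewrite ltnS leq_eqVlt => /orP[/eqP iN|iN _]; last by rewrite modn_small.
by have -> : ordS i = ord0; [apply: val_inj; rewrite /= iN modnn | rewrite b0].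
Qed.

Lemma ord_pred_white (B : {set V}) i : ends_blue B -> inl (ord_pred i) \notin B ->
  i = (ord_pred i).+1 :> nat.
Proof.
move=> /andP[_ b1]; rewrite /=; have [i0|i0] := posnP i.
  have -> : ord_pred i = ord_max; last by rewrite b1.
  by apply: val_inj; rewrite /= i0 add0n modn_small.
case: i i0 => [[|i] lti] //= _ _.
by rewrite modnDr modn_small // ltnW.
Qed.

Variant white_neighbor_spec (i : 'I_N.+1) : V -> Prop :=
| NextWhite (j : 'I_N.+1) of j = i.+1 :> nat : white_neighbor_spec i (inl j)
| PredWhite (j : 'I_N.+1) of i = j.+1 :> nat & j = ord_pred i :
    white_neighbor_spec i (inl j)
| LeafWhite (s : {i : 'I_N.+1 & 'I_(m i)}) of tag s = i :> nat :
    white_neighbor_spec i (inr s).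

Lemma white_neighborP (B : {set V}) i u : ends_blue B -> u \notin B ->
  e (inl i) u -> white_neighbor_spec i u.
Proof.
move=> bB; case: u => [j|s] uB /=; last by move=> /eqP si; apply: LeafWhite; rewrite si.
case/orP => /eqP eqj.
  by apply: NextWhite; rewrite eqj (ordS_white bB) // -eqj.
have jE : j = ord_pred i by rewrite eqj ordSK.
by apply: PredWhite => //; rewrite jE -(ord_pred_white bB) // -jE.
Qed.

(** A white path cannot jump over a blue cycle vertex. *)
Lemma connect_white_position (B : {set V}) (i : 'I_N.+1) u w :
  ends_blue B -> inl i \in B ->
  position u < i -> connect (white_adj e B) u w -> position w < i.
Proof.
move=> bB iB ui /connectP[p pP ->]; elim: p u ui pP => //= w' p IH u ui.
case/andP => /and3P[uB wB euw]; apply: IH.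
case: u uB euw ui => [j|s] uB euw /= ji.
  case: (white_neighborP bB wB euw) (wB) => [j' jj' j'B|j' jj' _ _|s si _] /=; try lia.
  have : j' != i by apply: contraNneq j'B => ->.
  by rewrite -val_eqE /= jj'; lia.
by case: w' wB euw => //= j' _ /eqP <-.
Qed.

Lemma connect_white_leaf (B : {set V}) (s : {i : 'I_N.+1 & 'I_(m i)}) w :
  inl (tag s) \in B -> connect (white_adj e B) (inr s) w -> w = inr s.
Proof.
move=> sB /connectP[[|w' p] //= /andP[/and3P[_ wB ew] _] _].
by case: w' wB ew => //= j wB /eqP sj; rewrite sj (negPf wB) in sB.
Qed.

(** Where the component announced on account of i starts: the cycle neighbour on
the left if it is white, otherwise a white pendant vertex.  The default value
inl i is reached only for a vertex without either. *)
Definition chosen (B : {set V}) (i : 'I_N.+1) : V :=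
  if inl (ord_pred i) \notin B then inl (ord_pred i)
  else odflt (inl i) [pick u in white_leaves B i].

Definition chosen_component (B : {set V}) (i : 'I_N.+1) : {set V} :=
  [set u in ~: B | connect (white_adj e B) (chosen B i) u].

(** When this fails, some active vertex has its right cycle neighbour as only
white neighbour and Rule 2 applies. *)
Definition no_bare_end (B : {set V}) : Prop :=
  {in active B, forall i, inl (ord_pred i) \in B -> white_leaves B i != set0}.

Lemma chosenP (B : {set V}) i : no_bare_end B -> i \in active B ->
  chosen B i \notin B /\ e (inl i) (chosen B i).
Proof.
move=> nb iA; rewrite /chosen; case: ifPn => [pB|].
  by split=> //=; rewrite ord_predK eqxx orbT.
rewrite negbK => /(nb _ iA) /set0Pn[u uL]; case: pickP => [w|/(_ u)]; last first.
  by rewrite uL.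
by rewrite inE => /andP[wB]; case: w wB.
Qed.

Lemma chosen_componentP (B : {set V}) i u : ends_blue B -> no_bare_end B ->
  i \in active B -> u \in chosen_component B i ->
  position u < i \/ u = chosen B i /\ position u = i.
Proof.
move=> bB nb iA; rewrite inE => /andP[_].
have [cB ec] := chosenP nb iA.
have iB : inl i \in B by move: iA; rewrite inE => /andP[].
move: cB ec; rewrite /chosen; case: ifPn => [pB _ _ |_].
  move=> cu; left; apply: (connect_white_position bB iB _ cu).
  by rewrite [leqRHS](ord_pred_white bB pB).
case: pickP => [w|_] /=; last by rewrite iB.
rewrite inE; case: w => [j|s] /andP[_ //] _ _ /= /eqP si cw.
have sB : inl (tag s) \in B by rewrite si.
by right; rewrite (connect_white_leaf sB cw) /= si.
Qed.

(** The component chosen for i lies to the left of i, or is a pendant vertex of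
i, so no active vertex further right sees it. *)
Lemma chosen_component_far (B : {set V}) (i j : 'I_N.+1) u :
  ends_blue B -> no_bare_end B ->
  i \in active B -> i < j -> u \notin B -> e (inl j) u ->
  u \notin chosen_component B i.
Proof.
move=> bB nb iA ij uB eju; apply/negP => /(chosen_componentP bB nb iA) uC.
have [cB _] := chosenP nb iA.
have iB : inl i \in B by move: iA; rewrite inE => /andP[].
case: (white_neighborP bB uB eju) (uB) uC => [j' jj' _|j' jj' _ j'B|s si _] /=; try lia.
case=> [|[_ j'i]]; first lia.
by move: j'B; rewrite (_ : j' = i) ?iB //; apply: val_inj.
Qed.

Lemma chosen_component_own (B : {set V}) i u : ends_blue B -> no_bare_end B ->
  i \in active B -> u \in chosen_component B i -> e (inl i) u -> u = chosen B i.
Proof.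
move=> bB nb iA uC eiu; have uB : u \notin B by move: uC; rewrite !inE => /andP[].
have [ui|[]//] := chosen_componentP bB nb iA uC.
case: (white_neighborP bB uB eiu) (uB) ui => [j jj' _|j jj' jE jB|s si _] /=; try lia.
by rewrite /chosen -jE jB.
Qed.

(** By [chosen_component_far] the chosen components are pairwise distinct, so
there are more than q of them; and in any subfamily kept by White the
rightmost active vertex sees only the vertex chosen for it. *)
Lemma free_force t (B : {set V}) : ends_blue B -> q < #|active B| ->
  (forall B' : {set V}, B \proper B' -> blue_wins e q t B') ->
  blue_wins e q t B.
Proof.
move=> bB qA win.
have winU w : w \notin B -> blue_wins e q t (w |: B).
  by move=> wB; apply/win/properUr; rewrite sub1set.
(* Either Rule 2 applies at the left end of a run, or every such end has a white
   pendant vertex to announce. *)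
have [/exists_inP[i iA /andP[pB /eqP noL]]|nb] := boolP
    [exists i in active B, (inl (ord_pred i) \in B) && (white_leaves B i == set0)].
  have [iB /existsP[w /andP[wB eiw]]] :
      inl i \in B /\ [exists u, (u \notin B) && e (inl i) u].
    by move: iA; rewrite inE => /andP[].
  have next x : x \notin B -> e (inl i) x -> x = inl (ordS i).
    move=> xB eix; case: (white_neighborP bB xB eix) (xB) => [j jE jB|j _ ->|s si sB].
    - congr inl; apply: val_inj => /=.
      by rewrite jE modn_small // -jE.
    - by rewrite pB.
    - have : inr s \in white_leaves B i by rewrite inE sB -val_eqE /= si eqxx.
      by rewrite noL inE.
  have wE := next w wB eiw.
  apply: (rule2 _ (winU w wB)).
  apply: (forces_inI iB _ wB eiw) => [|u _ uB eiu]; first by rewrite inE.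
  by rewrite wE (next u).
have {}nb : no_bare_end B.
  move=> i iA pB; apply: contraNneq nb => noL.
  by apply/exists_inP; exists i; rewrite // pB noL eqxx.
pose f := chosen_component B.
have fP i : i \in active B -> chosen B i \in f i.
  by move=> /(chosenP nb)[cB _]; rewrite !inE cB connect0.
have inj_f : {in active B &, injective f}.
  have le i j : i \in active B -> j \in active B -> f i = f j -> j <= i.
    move=> iA jA fij; rewrite leqNgt; apply/negP => ij.
    have [cB ec] := chosenP nb jA.
    by have := chosen_component_far bB nb iA ij cB ec; rewrite -/(f i) fij fP.
  move=> i j iA jA fij; apply/val_inj/eqP.
  by rewrite eqn_leq !le.
apply: (blue_wins_select (A := f @: active B)).
- apply/subsetP => _ /imsetP[i iA ->]; apply/imsetP; exists (chosen B i) => //.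
  by rewrite inE; case: (chosenP nb iA).
- by rewrite card_in_imset.
move=> S SA S0.
pose I := [set i in active B | f i \in S].
have [i0 i0I] : exists i, i \in I.
  have /set0Pn[W WS] := S0.
  have /imsetP[i iA WE] := subsetP SA _ WS.
  by exists i; rewrite inE iA -WE.
(* The rightmost active vertex whose component White has kept. *)
case: (arg_maxnP (fun i : 'I_N.+1 => i : nat) i0I) => i iI i_max.
have /andP[iA iS] : (i \in active B) && (f i \in S).
  by have : i \in I by []; rewrite inE.
have [cB ec] := chosenP nb iA.
exists (chosen B i |: B); last exact: winU.
have iB : inl i \in B by move: iA; rewrite inE => /andP[].
apply: forces_inI iB _ cB ec _ => [|u /bigcupP[W WS uW] uB eiu].
  by apply/bigcupP; exists (f i); rewrite ?fP.
have /imsetP[j jA WE] := subsetP SA _ WS.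
have ji : j <= i.
  by apply: i_max; rewrite -[is_true _]/(is_true (j \in I)) inE jA -WE.
move: uW; rewrite WE; move: ji; rewrite leq_eqVlt => /orP[/eqP ji|ji].
  have -> : j = i by apply: val_inj.
  by move=> uC; apply: (chosen_component_own bB nb iA uC).
by move=> uC; have := chosen_component_far bB nb jA ji uB eiu; rewrite -/(f j) uC.
Qed.

Lemma free_play t (B : {set V}) : ends_blue B ->
  (forall B' : {set V}, B \subset B' -> #|active B'| <= q ->
     blue_wins e q t B') ->
  blue_wins e q t B.
Proof.
have [c] := ubnP #|~: B|; elim: c B => // c IH B Bc bB win.
have [Aq|qA] := leqP #|active B| q; first exact: win.
apply: free_force => // B' BB'; apply: IH.
- by move: BB' Bc; rewrite -properC => /proper_card; lia.
- exact: ends_blueS (proper_sub BB') bB.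
- by move=> B'' /(subset_trans (proper_sub BB')); apply: win.
Qed.

(** * Halving the white runs *)

Definition run_starts (B : {set V}) : {set 'I_N.+1} :=
  [set i | (inl i \in B) && (inl (ordS i) \notin B)].

Lemma mem_active (B : {set V}) i u : inl i \in B -> u \notin B -> e (inl i) u ->
  i \in active B.
Proof.
by move=> iB uB eiu; rewrite inE iB; apply/existsP; exists u; rewrite uB.
Qed.

Lemma run_starts_active (B : {set V}) : run_starts B \subset active B.
Proof.
apply/subsetP => i; rewrite inE => /andP[iB sB].
by apply: mem_active iB sB _; rewrite /= eqxx.
Qed.

(** Every run starts after an active vertex, and the vertex that closes the last
run is active without being the start of a run. *)
Lemma card_run_starts (B : {set V}) : ends_blue B -> #|run_starts B| <= #|active B|.-1.
Proof.
move=> bB; have [->|[i0 i0L]] := set_0Vmem (run_starts B); first by rewrite cards0.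
case: (arg_maxnP (fun i : 'I_N.+1 => i : nat) i0L) => v vL v_max.
have /andP[vB sB] : (inl v \in B) && (inl (ordS v) \notin B).
  by have : v \in run_starts B by []; rewrite inE.
have sE := ordS_white bB sB.
have [_ b1] := andP bB.
have lastP : (v < (ord_max : 'I_N.+1)) && (inl (ord_max : 'I_N.+1) \in B).
  by rewrite b1 andbT /= -sE; have := ltn_ord (ordS v); rewrite ltnS; lia.
(* The blue vertex closing the last run. *)
case: (arg_minnP (P := fun i : 'I_N.+1 => (v < i) && (inl i \in B))
         (fun i : 'I_N.+1 => i : nat) lastP) => w /andP[vw wB] w_min.
have pE : (ord_pred w).+1 = w.
  by case: (w) vw => [[|w'] ltw] //= _; rewrite modnDr modn_small // ltnW.
have pB : inl (ord_pred w) \notin B.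
  apply/negP => pB; have [vp|] := ltnP v (ord_pred w).
    by have := w_min (ord_pred w); rewrite vp pB => /(_ isT); rewrite -[leqLHS]pE ltnn.
  rewrite -ltnS pE => wv.
  have wS : w = ordS v by apply/val_inj/eqP; rewrite [eqbRHS]sE eqn_leq wv.
  by rewrite -wS wB in sB.
have wA : w \in active B.
  by apply: mem_active wB pB _; rewrite /= ord_predK eqxx orbT.
suff /subset_leq_card : run_starts B \subset active B :\ w.
  by rewrite (cardsD1 w (active B)) wA.
rewrite subsetD1 run_starts_active; apply/negP => wL.
by have : w <= v := v_max w wL; rewrite leqNgt vw.
Qed.

Definition gapped (l : nat) (B : {set V}) : Prop :=
  forall i, i + l < N.+1 -> exists2 j : 'I_N.+1, i <= j <= i + l & inl j \in B.

Lemma gapped_subset l (B B' : {set V}) : B \subset B' -> gapped l B -> gapped l B'.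
Proof.
by move=> /subsetP sB gB i /gB[j ij jB]; exists j => //; apply: sB.
Qed.

(** One token h + 1 steps after the start of each run.  A window of h + 1 white
positions that avoids these tokens would begin more than h + 1 steps after the
start of its run, and so give 2 h + 2 > l consecutive white positions. *)
Lemma halve_gaps l h (B : {set V}) : ends_blue B -> l <= h.*2.+1 -> gapped l B ->
  exists2 X : {set V}, #|X| <= #|active B|.-1 & gapped h (X :|: B).
Proof.
move=> bB lh gB.
pose mid (a : 'I_N.+1) : V := inl (inord (a + h.+1)).
exists (mid @: run_starts B).
  exact: leq_trans (leq_imset_card _ _) (card_run_starts bB).
move=> i iN; have [|nB] := pselect (exists2 j : 'I_N.+1, i <= j <= i + h & inl j \in B).
  by case=> j ij jB; exists j; rewrite // inE jB orbT.
have white (j : 'I_N.+1) : i <= j <= i + h -> inl j \notin B.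
  by move=> ij; apply/negP => jB; apply: nB; exists j.
have [b0 _] := andP bB.
have i_gt0 : 0 < i.
  by rewrite lt0n; apply/eqP => i0; apply/negP: b0; apply: white; rewrite i0.
have P0 : ((@ord0 N) < i) && (inl (@ord0 N) \in B) by rewrite b0 i_gt0.
(* The start of the run that contains position i. *)
case: (arg_maxnP (P := fun j : 'I_N.+1 => (j < i) && (inl j \in B))
  (fun j : 'I_N.+1 => j : nat) P0) => a /andP[ai aB] a_max.
have aft (j : 'I_N.+1) : a < j <= i + h -> inl j \notin B.
  move=> /andP[aj jih]; have [ij|ji] := leqP i j; first by apply: white; rewrite ij.
  apply/negP => jB; have /a_max : (j < i) && (inl j \in B) by rewrite ji jB.
  by rewrite /= leqNgt aj.
have aL : a \in run_starts B.
  by rewrite inE aB; apply: aft; rewrite /= modn_small; lia.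
have [far|near] := leqP (a + h.+2) i.
  have [|j aj jB] := gB a.+1; first lia.
  by have := aft j; rewrite jB => /(_ _)/negP[] //; lia.
exists (inord (a + h.+1)); last by rewrite inE imset_f.
by rewrite inordK; lia.
Qed.

Lemma card_white_leaves (B : {set V}) i : #|white_leaves B i| <= k.
Proof.
apply: leq_trans (m_lek i).
rewrite -[m i]card_ord.
have sub : white_leaves B i \subset
    [set (inr (Tagged (fun i => 'I_(m i)) j) : V) | j in [set: 'I_(m i)]].
  apply/subsetP => u; rewrite inE; case: u => [j|[j s]] /andP[_ //] /= /eqP ji.
  by subst j; apply: imset_f; rewrite inE.
by apply: leq_trans (subset_leq_card sub) _; rewrite -[leqRHS]cardsT leq_imset_card.
Qed.

(** Tokens on all white pendant vertices of i but one let i force the last one;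
this makes i inactive for at most k - 1 tokens. *)
Lemma finish_blue_cycle c t (B : {set V}) : (forall i, inl i \in B) -> #|active B| <= c ->
  blue_wins e q (t + c * (k - 1)) B.
Proof.
elim: c t B => [|c IH] t B cB Ac.
  rewrite leqn0 cards_eq0 in Ac.
  suff -> : B = [set: V] by apply: all_blue.
  apply/setP => u; rewrite inE; apply/negPn/negP => uB.
  have [i eiu] : exists i, e (inl i) u.
    by case: u uB => [i|s _]; [rewrite cB | exists (tag s) => /=].
  by have := mem_active (cB i) uB eiu; rewrite (eqP Ac) inE.
have [A0|[i iA]] := set_0Vmem (active B).
  apply: blue_wins_leq (IH t B cB _); last by rewrite A0 cards0.
  by rewrite leq_add2l leq_mul2r leqnSn orbT.
have [u0 u0L] : exists u, u \in white_leaves B i.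
  move: iA; rewrite inE => /andP[_ /existsP[[j|s] /andP[uB eiu]]].
    by rewrite cB in uB.
  by exists (inr s); rewrite inE uB.
have tE : t + c.+1 * (k - 1) = t + c * (k - 1) + (k - 1) by rewrite mulSn; lia.
rewrite tE; have cX : #|white_leaves B i :\ u0| <= k - 1.
  by have := card_white_leaves B i; rewrite (cardsD1 u0) u0L; lia.
apply: (@blue_wins_leq _ _ _ (t + c * (k - 1) + #|white_leaves B i :\ u0|)).
  by rewrite leq_add2l.
apply: blue_wins_tokens.
set B1 := _ :|: B.
have [u0B eu0] : u0 \notin B /\ e (inl i) u0.
  by move: u0L; rewrite inE => /andP[uB]; case: u0 uB {cX B1}.
have u0B1 : u0 \notin B1 by rewrite !inE eqxx (negPf u0B).
have iB1 : inl i \in B1 by rewrite inE cB orbT.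
apply: (@rule2 _ _ _ _ _ (u0 |: B1)).
  apply: (forces_inI iB1 _ u0B1 eu0) => [|u _ uB1 eiu]; first by rewrite inE.
  apply: contraNeq uB1 => uu0; rewrite 2!inE in_set1 uu0 /=.
  case: u uu0 eiu => [j|s] _ /=; first by rewrite cB orbT.
  by rewrite inE /= => ->; rewrite andbT orNb.
apply: IH => [j|]; first by rewrite !inE cB !orbT.
rewrite -ltnS; apply: leq_trans Ac; apply: proper_card.
apply/properP; split.
  apply/subsetP => j; rewrite !inE cB !orbT /= => /existsP[u /andP[uB eju]].
  apply/existsP; exists u; rewrite eju andbT.
  by apply: contraNN uB; rewrite !inE => ->; rewrite !orbT.
exists i => //; rewrite !inE cB !orbT /=; apply/existsPn => u.
rewrite negb_and negbK; case: u => [j|s]; first by rewrite !inE cB !orbT.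
rewrite !inE /=; case: eqP => //= _; case: (tag s == i) => //=; last by rewrite orbT.
by rewrite andbT orNb.
Qed.

Lemma halving_rounds r (B : {set V}) : ends_blue B -> gapped (2 ^ r).-1 B ->
  blue_wins e q (r * q.-1 + q * (k - 1)) B.
Proof.
elim: r B => [|r IH] B bB gB; apply: (free_play bB) => B' BB' A'.
  apply: finish_blue_cycle A' => i; have [|j] := gapped_subset BB' gB (i := i).
    by rewrite expn0 addn0.
  by rewrite expn0 addn0 -eqn_leq => /eqP/val_inj <-.
have bB' := ends_blueS BB' bB.
have [|X cX gX] := halve_gaps (h := (2 ^ r).-1) bB' _ (gapped_subset BB' gB).
  by rewrite expnS; lia.
apply: (@blue_wins_leq _ _ _ (r * q.-1 + q * (k - 1) + #|X|)).
  by rewrite mulSn; lia.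
apply: blue_wins_tokens; apply: IH gX.
exact: ends_blueS (subsetUr _ _) bB'.
Qed.

(** The initial tokens are on the multiples of 2^r below p 2^r, which suffice
because n < 4 2^r <= p 2^r, and on the last position. *)
Lemma Zq_upper r p : 4 <= p -> 2 ^ r.+1 <= N.+1 < 2 ^ r.+2 ->
  Zq e q <= r * q.-1 + q * (k - 1) + p.+1.
Proof.
move=> p4 /andP[_ Nr]; rewrite /Zq; case: ex_minnP => t _; apply; apply/asboolP.
pose cut (i : 'I_p) : V := inl (inord (i * 2 ^ r)).
pose X := inl ord_max |: [set cut i | i in [set: 'I_p]].
have cX : #|X| <= p.+1.
  rewrite cardsU1; apply: (@leq_add _ _ 1); first exact: leq_b1.
  by apply: leq_trans (leq_imset_card _ _) _; rewrite cardsT card_ord.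
apply: (@blue_wins_leq _ _ _ (r * q.-1 + q * (k - 1) + #|X|)).
  by rewrite leq_add2l.
apply: blue_wins_tokens; rewrite setU0.
have r0 : 0 < 2 ^ r by rewrite expn_gt0.
have cutX (i : nat) : i < p -> inl (inord (i * 2 ^ r)) \in X.
  by move=> ip; rewrite inE; apply/orP; right; apply/imsetP; exists (Ordinal ip).
apply: halving_rounds.
  rewrite /ends_blue (_ : inl ord0 \in X) ?setU11 //.
  have /cutX : 0 < p by lia.
  by rewrite mul0n (_ : inord 0 = ord0) //; apply: val_inj; rewrite /= inordK.
move=> i iN; pose c := (i + (2 ^ r).-1) %/ 2 ^ r.
have c_le : c * 2 ^ r <= i + (2 ^ r).-1 by exact: leq_divM.
have c_gt : i + (2 ^ r).-1 < c.+1 * 2 ^ r by rewrite ltn_ceil.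
exists (inord (c * 2 ^ r)); last first.
  apply: cutX; rewrite -(ltn_pmul2r r0).
  apply: (leq_ltn_trans c_le); apply: (ltn_trans iN); apply: (leq_trans Nr).
  by rewrite !expnS !mulnA leq_mul2r p4 orbT.
by rewrite inordK; rewrite mulSn in c_gt; lia.
Qed.

End UpperBound.

(** * Comparison with the logarithmic bounds *)

Local Open Scope ring_scope.

Import Order.TTheory GRing.Theory Num.Theory.

Lemma log_lower_bound (R : realType) (n s : nat) : (0 < n)%N -> (n < 3 ^ s.+1)%N ->
  2 * log 3 2 * log 2 (n%:R / 200) <= (2 * s)%:R :> R.
Proof.
move=> n0 ns.
have ln2 : 0 < ln 2 :> R by rewrite ln_gt0 // ltr1n.
have ln3 : 0 < ln 3 :> R by rewrite ln_gt0 // ltr1n.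
have -> : 2 * log 3 2 * log 2 (n%:R / 200) = 2 * (ln (n%:R / 200) / ln 3) :> R.
  by rewrite /log; field; rewrite !gt_eqF.
rewrite natrM ler_pM2l ?ltr0n // ler_pdivrMr // [s%:R * _]mulr_natl -lnXn ?ltr0n //.
rewrite ler_ln ?posrE ?divr_gt0 ?exprn_gt0 ?ltr0n // ler_pdivrMr ?ltr0n //.
rewrite -natrX -natrM ler_nat.
by move: ns; rewrite expnS; lia.
Qed.

Lemma log2_lower_bound (R : realType) (n r : nat) : (2 ^ r <= n)%N ->
  r%:R <= log 2 n%:R :> R.
Proof.
move=> rn; have n0 : (0 < n)%N by apply: leq_trans rn; rewrite expn_gt0.
have ln2 : 0 < ln 2 :> R by rewrite ln_gt0 // ltr1n.
rewrite /log ler_pdivlMr // mulr_natl -lnXn ?ltr0n //.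
by rewrite ler_ln ?posrE ?exprn_gt0 ?ltr0n // -natrX ler_nat.
Qed.

Theorem theorem4p19 (R : realType) (n k q x p : nat)
  (hn : (3 <= n)%N) (hk : (2 <= k)%N) (hq : (3 <= q)%N)
  (hx : x = 0%N \/ x = 1%N) (hxq : (x = q + 1 %[mod 2])%N)
  (hp : p = (q + 1 + x)%N)
  (m : 'I_n -> nat) (hm : forall i : 'I_n, (2 <= m i <= k)%N) :
  2 * log 3 2 * log 2 (n%:R / 200) <= (Zq (pendant_cycle m) q)%:R :> R
  /\
  (Zq (pendant_cycle m) q)%:R
    <= (p%:R - 2) * log 2 n%:R + p%:R + k%:R - q%:R + q%:R * (k%:R - 1) :> R.
Proof.
split.
  have [s sE] : exists s, trunc_log 3 n = s.+1.
    have : (1 <= trunc_log 3 n)%N by rewrite trunc_log_max.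
    by case: trunc_log => // s _; exists s.
  have lo : (3 ^ s.+1 <= n)%N by rewrite -sE trunc_logP //; lia.
  have hi : (n < 3 ^ s.+2)%N by rewrite -sE trunc_log_ltn.
  apply: (le_trans (log_lower_bound R _ hi)); first lia.
  rewrite ler_nat; apply: Zq_lower lo => // i.
  by have /andP[] := hm i.
have [r rE] : exists r, trunc_log 2 n = r.+1.
  have : (1 <= trunc_log 2 n)%N by rewrite trunc_log_max //; lia.
  by case: trunc_log => // r _; exists r.
have lo : (2 ^ r.+1 <= n)%N by rewrite -rE trunc_logP //; lia.
have hi : (n < 2 ^ r.+2)%N by rewrite -rE trunc_log_ltn.
have up : (Zq (pendant_cycle m) q <= r * q.-1 + q * (k - 1) + p.+1)%N.
  case: n hn m hm lo hi {rE} => // N hn m hm lo hi.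
  apply: Zq_upper.
  - by move=> i; have /andP[] := hm i.
  - by lia.
  - by rewrite lo.
have logn := log2_lower_bound R lo.
rewrite -(ler_nat R) in up; apply: (le_trans up).
have slope : (q.-1%:R : R) <= p%:R - 2.
  rewrite -[2]/(2%:R) -natrB ?ler_nat; lia.
have main : q.-1%:R * r.+1%:R <= (p%:R - 2) * log 2 n%:R :> R.
  by apply: ler_pM => //; rewrite ler0n.
have k2 : 2 <= k%:R :> R by rewrite (ler_nat R 2).
have qE : q.-1%:R + 1 = q%:R :> R by rewrite natr1 prednK //; lia.
have kE : (k - 1)%:R = k%:R - 1 :> R by rewrite natrB //; lia.
have succ i : i.+1%:R = i%:R + 1 :> R by rewrite natr1.
rewrite !natrD !natrM kE succ.
rewrite succ mulrDr mulr1 in main.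
rewrite [r%:R * _]mulrC; lra.
Qed.
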